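(* The equilibrium distributions of the Directed Random Market process, i.e. the probability densities $p$ on $[0,\infty)$ satisfying $T[p]=p$ almost everywhere, where $$T[p](x)=\frac{1}{2}\int_0^x p(x-u)\int_u^\infty \frac{1}{v}p(v)\,dv\,du+\frac{1}{2}\int_x^\infty \frac{1}{u}p(u)\,du ,$$ are exactly (up to equality almost everywhere) the densities $$p_w^{*}(x)=\frac{1}{\sqrt{2w\pi x}}\,e^{-\frac{x}{2w}},\qquad x>0,$$ with $w>0$, where $w$ is the mean of the distribution, $w=\int_0^\infty x\,p_w^{*}(x)\,dx$.
   Context: A probability density on $[0,\infty)$ is an a.e. non-negative function $p\in L^1[0,\infty)$ with $\|p\|_{L^1}=1$; densities that agree almost everywhere are identified. The operator $T$ acts on probability densities by the displayed formula (for a.e. $x>0$) and describes one discrete time step $p_{t+1}=T[p_t]$ of the wealth density in the Directed Random Market process. An equilibrium distribution is by definition a probability density that is a fixed point of $T$. The equilibrium distributions are parameterized by their mean wealth $w$. *)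

(* Defs.v *)
From HB Require Import structures.
From mathcomp Require Import all_boot all_order all_algebra.
From mathcomp Require Import all_classical all_reals all_analysis.

Set Implicit Arguments.
Unset Strict Implicit.
Unset Printing Implicit Defensive.

Import Order.TTheory GRing.Theory Num.Theory.
Import numFieldNormedType.Exports.

Local Open Scope classical_set_scope.
Local Open Scope ring_scope.

(* A density on [0, +oo[ is represented by a function on the whole line of
   which only the restriction to [0, +oo[ is ever used. Integrability includes
   Borel measurability; every class of L^1[0, +oo[ has a Borel representative. *)
Definition is_prob_density (R : realType) (p : R -> R) : Prop :=
  [/\ (@lebesgue_measure R).-integrable `[0, +oo[ (EFin \o p),
      {ae @lebesgue_measure R, forall x : R, 0 <= x -> 0 <= p x}
    & (\int[@lebesgue_measure R]_(x in `[0%R, +oo[) (`|p x|%R)%:E = 1)%E].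

(* Extended-real valued, so that an infinite or a priori undetermined integral
   is not silently truncated to a real number. The inner integral may be +oo at
   u = 0 only, and the value is finite for almost every x > 0 when p is a
   density. *)
Definition drm_operator (R : realType) (p : R -> R) (x : R) : \bar R :=
  ((2^-1)%:E *
     \int[@lebesgue_measure R]_(u in `[0%R, x])
       ((p (x - u)%R)%:E *
        \int[@lebesgue_measure R]_(v in `[u, +oo[) (v^-1 * p v)%:E)
   + (2^-1)%:E *
     \int[@lebesgue_measure R]_(u in `[x, +oo[) (u^-1 * p u)%:E)%E.

Definition is_equilibrium (R : realType) (p : R -> R) : Prop :=
  is_prob_density p /\
  {ae @lebesgue_measure R, forall x : R, 0 < x -> drm_operator p x = (p x)%:E}.

Definition mean_wealth (R : realType) (p : R -> R) : \bar R :=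
  (\int[@lebesgue_measure R]_(x in `[0%R, +oo[) (x * p x)%:E)%E.

Definition drm_equilibrium_density (R : realType) (w x : R) : R :=
  (Num.sqrt (2 * w * pi * x))^-1 * expR (- (x / (2 * w))).

(* Main.v *)
(* Write P for the Laplace transform of p and F(s) = int p(x) (1 - e^(-sx)) / x dx,
   so that F' = P and F(s) / s is the Laplace transform of the weighted tail
   u |-> int_u^oo p(v) / v dv.  By Tonelli's theorem T[p] has the transform
   (P + 1) F / (2 s), hence a fixed point of T satisfies 2 s F' = (F' + 1) F.
   The quantity (s - F) / F^2 is a first integral of this equation; calling its
   value w / 2, the relation s = F + (w / 2) F^2 forces P = (1 + 2 w s)^(-1/2),
   which is the transform of the density p_w.  Laplace transforms being
   injective, p = p_w.  Conversely, T[p_w] and p_w have the same transform. *)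

Require Import Defs.
From HB Require Import structures.
From mathcomp Require Import all_boot all_order all_algebra.
From mathcomp Require Import all_classical all_reals all_analysis.
From mathcomp Require Import measurable_realfun ring lra.

Set Implicit Arguments.
Unset Strict Implicit.
Unset Printing Implicit Defensive.

Import Order.TTheory GRing.Theory Num.Theory.
Import numFieldNormedType.Exports.

Local Open Scope classical_set_scope.
Local Open Scope ring_scope.

(** * Injectivity of the Laplace transform *)

Section laplace_injectivity.
Context {R : realType}.
Local Notation mu := (@lebesgue_measure R).

(** The weight 1 - e^(-sx) is there because p(x) / x need not be integrable at 0, and is not for
    p_w, whereas (1 - e^(-sx)) / x stays below s. The first integral appears on reading s as a
    function of F: the equation becomes 2 s = (1 + ds/dF) F, which is linear with solutions s = F +
    c F^2. An equilibrium is not assumed to have a finite mean, so w cannot be taken as -P'(0); it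
    enters as twice the constant c, and that it is the mean is checked on p_w alone. Since an
    equilibrium is only nonnegative almost everywhere and arbitrary on the left half-line,
    transforms are computed for a nonnegative Borel representative vanishing there; the integrals
    are then extended-valued and Tonelli asks for no finiteness. *)

Lemma ae_imply (P Q : R -> Prop) : (forall x, P x -> Q x) ->
  {ae mu, forall x, P x} -> {ae mu, forall x, Q x}.
Proof.
move=> PQ [N [mN N0 PN]]; exists N; split => // x nQ; apply: PN => Px.
exact/nQ/PQ.
Qed.

Lemma ae_imply2 (P Q S : R -> Prop) : (forall x, P x -> Q x -> S x) ->
  {ae mu, forall x, P x} -> {ae mu, forall x, Q x} -> {ae mu, forall x, S x}.
Proof.
move=> PQS [N [mN N0 PN]] [M [mM M0 QM]].
exists (N `|` M); split; first exact: measurableU.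
  by apply: null_set_setU.
move=> x nS; have [Px|nP] := pselect (P x); last by left; exact: PN.
by right; apply: QM => Qx; exact/nS/PQS.
Qed.

(* x^-1 = x * (x^2)^-1 is also valid at 0, where 0^-1 = 0. *)
Lemma measurable_invr :
  measurable_fun [set: R] (fun x : R => x^-1).
Proof.
have -> : (fun x : R => x^-1) = fun x : R => x * (x ^+ 2) `^ (-1).
  apply/funext => x; have [->|x0] := eqVneq x 0; first by rewrite invr0 mul0r.
  by rewrite powR_inv1 ?sqr_ge0// expr2 invfM mulrA mulfV// mul1r.
apply: measurable_funM => //.
exact: (measurableT_comp (measurable_powR _)).
Qed.

Lemma measurable_expRNM d (T : measurableType d) (s : R) (D : set T)
    (f : T -> R) : measurable_fun D f ->
  measurable_fun D (fun x => expR (- (s * f x))).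
Proof.
move=> mf; under eq_fun do rewrite -mulNr.
by apply: measurableT_comp => //; exact: measurable_funM.
Qed.

Lemma expRNM_itv (s x : R) : 0 <= s -> 0 <= x -> 0 < expR (- (s * x)) <= 1.
Proof.
by move=> s0 x0; rewrite expR_gt0/= -expR0 ler_expR oppr_le0 mulr_ge0.
Qed.

Lemma integrable_bounded1M (k h : R -> R) (D : set R) : measurable D ->
  measurable_fun D k -> (forall x, D x -> `|k x| <= 1) ->
  mu.-integrable D (EFin \o h) ->
  mu.-integrable D (fun x => (k x * h x)%:E).
Proof.
move=> mD mk k1 ih.
rewrite (_ : (fun x => _) = (EFin \o k) \* (EFin \o h))%E//.
apply: integrableMr => //; exists 1; split => // M M1 x Dx.
exact: le_trans (k1 _ Dx) (ltW M1).
Qed.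

(** The extra factor turns e^(-sx) into e^(-sx) - e^(-(s+c)x), so the induction on [n] must hold for
    all s at once. This replaces a binomial expansion. *)
Lemma integral_laplace_pow0 (h : R -> R) :
  mu.-integrable `]0, +oo[ (EFin \o h) ->
  (forall s : R, 0 <= s ->
    (\int[mu]_(x in `]0%R, +oo[) (expR (- (s * x)) * h x)%:E = 0)%E) ->
  forall (c : R), 0 <= c -> forall (n : nat) (s : R), 0 <= s ->
    (\int[mu]_(x in `]0%R, +oo[)
       (((1 - expR (- (c * x))) ^+ n * expR (- (s * x))) * h x)%:E = 0)%E.
Proof.
move=> ih h0 c c0; elim=> [|n IH] s s0.
  by rewrite -[RHS](h0 s)//; apply: eq_integral => x _; rewrite expr0 mul1r.
have il (t : R) : 0 <= t -> mu.-integrable `]0, +oo[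
    (fun x => (((1 - expR (- (c * x))) ^+ n * expR (- (t * x))) * h x)%:E).
  move=> t0; apply: integrable_bounded1M => //.
    apply: measurable_funM; last exact: measurable_expRNM.
    by apply: measurable_funX; apply: measurable_funB => //; exact: measurable_expRNM.
  move=> x /=; rewrite in_itv/= andbT => /ltW x0.
  have /andP[a0 a1] := expRNM_itv c0 x0; have /andP[b0 b1] := expRNM_itv t0 x0.
  rewrite normrM normrX [`|1 - _|]ger0_norm ?subr_ge0// ger0_norm ?expR_ge0//.
  apply: mulr_ile1 => //.
    by rewrite exprn_ge0// subr_ge0.
  by rewrite exprn_ile1 ?subr_ge0// gerBl ltW.
under eq_integral => x _.
  rewrite (_ : _ * h x = ((1 - expR (- (c * x))) ^+ n * expR (- (s * x))) * h x
    - ((1 - expR (- (c * x))) ^+ n * expR (- ((s + c) * x))) * h x); last first.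
    by rewrite [(s + c) * x]mulrDl opprD expRD exprSr; ring.
  rewrite EFinB.
over.
rewrite integralB_EFin//; last 2 first.
- exact: il.
- by apply: il; rewrite addr_ge0.
by rewrite !IH ?sube0// addr_ge0.
Qed.

Lemma bernoulli_le (t : R) (m : nat) : 0 <= t <= 1 ->
  1 - t *+ m <= (1 - t) ^+ m.
Proof.
move=> /andP[t0 t1]; elim: m => [|m IH]; first by rewrite mulr0n subr0.
rewrite exprS; apply: (le_trans _ (ler_wpM2l _ IH)); last by rewrite subr_ge0.
rewrite mulrBl mul1r mulrBr mulr1 mulrSr.
have : 0 <= t * t *+ m by rewrite mulrn_wge0// mulr_ge0.
rewrite mulrnAr; lra.
Qed.

(** From (1 - t)^m (1 + t)^m = (1 - t^2)^m <= 1 together with Bernoulli's bound 1 + m t <= (1 +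
    t)^m. *)
Lemma bernoulli_inv_le (t : R) (m : nat) : 0 <= t <= 1 ->
  (1 - t) ^+ m <= (1 + t *+ m)^-1.
Proof.
move=> /andP[t0 t1].
have d0 : 0 < 1 + t *+ m by rewrite ltr_pwDl// mulrn_wge0.
rewrite -[leRHS]div1r ler_pdivlMr//.
have : (1 - t) ^+ m * (1 + t) ^+ m <= 1.
  rewrite -exprMn exprn_ile1//; nra.
apply: le_trans; apply: ler_wpM2l; first by rewrite exprn_ge0// subr_ge0.
elim: m {d0} => [|m IH]; first by rewrite mulr0n addr0.
rewrite exprS; apply: (le_trans _ (ler_wpM2l _ IH)); last by rewrite addr_ge0.
rewrite mulrDl mul1r mulrDr mulr1 mulrSr.
have : 0 <= t * t *+ m by rewrite mulrn_wge0// mulr_ge0.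
rewrite mulrnAr; lra.
Qed.

(** In Bernoulli's bounds with t = y^n and m = 2^n the product t m is (2 y)^n, which tends to 0 or
    to infinity according to the side of 1/2 on which y lies: the exponent 2^n is what puts the
    threshold at 1/2. *)
Lemma cvg_threshold1 (y : R) : 0 <= y < 2^-1 ->
  (1 - y ^+ n) ^+ (2 ^ n) @[n --> \oo] --> (1 : R).
Proof.
move=> /andP[y0 y1].
have yn (n : nat) : 0 <= y ^+ n <= 1.
  by rewrite exprn_ge0//= exprn_ile1//; lra.
apply: (@squeeze_cvgr _ _ _ _ (fun n => 1 - (2 * y) ^+ n) (cst 1)).
- apply: nearW => n; have /andP[n0 n1] := yn n.
  rewrite /cst exprn_ile1 ?gerBl ?subr_ge0// andbT.
  by rewrite (le_trans _ (bernoulli_le _ (yn n)))// -[_ *+ (2 ^ _)]mulr_natl natrX -exprMn.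
- rewrite -[X in _ --> X]subr0; apply: cvgB; first exact: cvg_cst.
  by apply: cvg_expr; rewrite ger0_norm; lra.
- exact: cvg_cst.
Qed.

Lemma cvg_threshold0 (y : R) : 2^-1 < y <= 1 ->
  (1 - y ^+ n) ^+ (2 ^ n) @[n --> \oo] --> (0 : R).
Proof.
move=> /andP[y1 y2].
have yn (n : nat) : 0 <= y ^+ n <= 1.
  by rewrite exprn_ge0/= ?exprn_ile1//; lra.
apply: (@squeeze_cvgr _ _ _ _ (cst 0) (fun n => ((2 * y)^-1) ^+ n)).
- apply: nearW => n; have /andP[n0 n1] := yn n.
  rewrite /cst exprn_ge0 ?subr_ge0//= (le_trans (bernoulli_inv_le _ (yn n)))//.
  have q0 : 0 < (2 * y) ^+ n by rewrite exprn_gt0//; lra.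
  rewrite exprVn lef_pV2 ?posrE//; last first.
    by rewrite ltr_pwDl// mulrn_wge0.
  by rewrite -[_ *+ (2 ^ _)]mulr_natl natrX -exprMn lerDr.
- exact: cvg_cst.
- apply: cvg_expr; rewrite ger0_norm ?invr_ge0; last lra.
  by rewrite invf_lt1; lra.
Qed.

(* (1 - 2^(-n x / a))^(2^n) is a polynomial in exponentials e^(-s x) and tends to
   the indicator of x > a, by Bernoulli's inequality. *)
Lemma integral_tail_eq0 (h : R -> R) :
  mu.-integrable `]0, +oo[ (EFin \o h) ->
  (forall s : R, 0 <= s ->
    (\int[mu]_(x in `]0%R, +oo[) (expR (- (s * x)) * h x)%:E = 0)%E) ->
  forall a : R, 0 < a -> (\int[mu]_(x in `]a, +oo[) (h x)%:E = 0)%E.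
Proof.
move=> ih h0 a a0.
have mh : measurable_fun (`]0, +oo[%classic : set R) h.
  by case/integrableP : ih => /measurable_EFinP.
(* This rate makes e^(-cx) cross the threshold 1/2 exactly at x = a. *)
pose c := ln 2 / a.
have c0 : 0 < c by rewrite divr_gt0// ln_gt0// ltr1n.
have yE (x : R) (n : nat) : expR (- (n%:R * c * x)) = expR (- (c * x)) ^+ n.
  by rewrite -mulrA -mulrN expRM_natl.
have ca : expR (- (c * a)) = 2^-1.
  by rewrite /c divfK ?gt_eqF// expRN lnK// posrE.
have ynb (n : nat) (x : R) : `]0, +oo[%classic x -> 0 <= expR (- (n%:R * c * x)) <= 1.
  rewrite /= in_itv/= andbT => x0.
  have /andP[? ->] := @expRNM_itv (n%:R * c) x (mulr_ge0 (ler0n _ _) (ltW c0)) (ltW x0).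
  by rewrite ltW.
pose f_ (n : nat) (x : R) : \bar R :=
  ((1 - expR (- (n%:R * c * x))) ^+ (2 ^ n) * h x)%:E.
pose f (x : R) : \bar R := (\1_(`]a, +oo[%classic : set R) x * h x)%:E.
have mpow n : measurable_fun (`]0, +oo[%classic : set R)
    (fun x => (1 - expR (- (n%:R * c * x))) ^+ (2 ^ n)).
  apply: measurable_funX; apply: measurable_funB => //.
  exact: measurable_expRNM.
have [|||||_ _] := @dominated_convergence _ _ _ mu (`]0, +oo[%classic : set R)
    (measurable_itv _) f_ f (EFin \o ((fun x => `|x|) \o h)).
- by move=> n; apply/measurable_EFinP; exact: measurable_funM (mpow n) mh.
- by apply/measurable_EFinP/measurable_funM => //; exact: measurable_indic.
(* At x = a the sequence is (1 - 2^(-n))^(2^n), with limit 1/e, so this point has to be left out. *)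
- exists [set a]; split => //; first exact: lebesgue_measure_set1.
  move=> x /= nx; apply: contrapT => xa; apply: nx => x0.
  apply: cvg_EFin; first exact: nearW.
  apply: cvgMr_tmp.
  have [ax|ax] := ltP a x.
  + rewrite indicE mem_set/=; last by rewrite in_itv/= ax.
    under eq_fun do rewrite yE.
    apply: cvg_threshold1; rewrite expR_ge0/= -ca ltr_expR ltrN2.
    by rewrite ltr_pM2l.
  + have {}ax : x < a by rewrite lt_neqAle ax andbT; apply/eqP.
    rewrite indicE memNset/=; last by rewrite in_itv/= andbT; apply/negP; rewrite -leNgt ltW.
    under eq_fun do rewrite yE.
    apply: cvg_threshold0; rewrite -ca ltr_expR ltrN2 ltr_pM2l// ax/=.
    by have := ynb 1 x x0; rewrite mul1r => /andP[].
- exact: integrable_norm.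
- apply: aeW => x n x0 /=; rewrite lee_fin normrM.
  apply: ler_piMl => //; have /andP[e0 e1] := ynb n x x0.
  by rewrite normrX exprn_ile1// ger0_norm ?subr_ge0// gerBl.
have fn0 (n : nat) : (\int[mu]_(x in `]0%R, +oo[) f_ n x = 0)%E.
  rewrite -[RHS](@integral_laplace_pow0 h ih h0 (n%:R * c)
    (mulr_ge0 (ler0n _ _) (ltW c0)) (2 ^ n) 0 (lexx _)).
  by apply: eq_integral => x _; rewrite mul0r oppr0 expR0 mulr1.
under eq_fun do rewrite fn0.
have -> : (\int[mu]_(x in `]0%R, +oo[) f x = \int[mu]_(x in `]a, +oo[) (h x)%:E)%E.
  have -> : `]a, +oo[%classic = `]0, +oo[ `&` `]a, +oo[ :> set R.
    by rewrite setIidr//; apply: subset_itvr; rewrite bnd_simp ltW.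
  rewrite integral_mkcondr; apply: eq_integral => x _.
  rewrite /f patchE indicE; case: ifPn => _; first by rewrite mul1r.
  by rewrite mul0r.
move/cvg_lim => /(_ (@ereal_hausdorff R)) <-; by rewrite lim_cst.
Qed.

(** Since all tails vanish, so does every integral of h over ]0, y]; Lebesgue differentiation of
    this zero primitive recovers h almost everywhere. The extension [H] by zero puts h on the whole
    line, where [FTC1] applies. *)
Lemma laplace_eq0_ae (h : R -> R) :
  mu.-integrable `]0, +oo[ (EFin \o h) ->
  (forall s : R, 0 <= s ->
    (\int[mu]_(x in `]0%R, +oo[) (expR (- (s * x)) * h x)%:E = 0)%E) ->
  {ae mu, forall x, 0 < x -> h x = 0}.
Proof.
move=> ih h0.
have tail0 a : 0 <= a -> (\int[mu]_(x in `]a, +oo[) (h x)%:E = 0)%E.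
  rewrite le_eqVlt => /predU1P[<-|]; last exact: integral_tail_eq0.
  rewrite -[RHS](h0 0)//; apply: eq_integral => x _.
  by rewrite mul0r oppr0 expR0 mul1r.
pose H := h \_ `]0, +oo[.
have iH : mu.-integrable [set: R] (EFin \o H).
  by rewrite /H -restrict_EFin; apply/(integrable_mkcond _ _).1.
have F0 y : (\int[mu]_(t in `]0, y]) H t)%R = 0.
  have [y0|y0] := leP y 0.
    by rewrite set_itv_ge ?bnd_simp -?leNgt// Rintegral_set0.
  rewrite /Rintegral.
  have -> : (\int[mu]_(t in `]0%R, y]) (H t)%:E = \int[mu]_(t in `]0%R, y]) (h t)%:E)%E.
    apply: eq_integral => t; rewrite inE/= in_itv/= => /andP[t0 _].
    by rewrite /H patchE mem_set//= in_itv/= t0.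
  have yU : `]0, +oo[%classic = `]0, y] `|` `]y, +oo[ :> set R.
    by rewrite -itv_bndbnd_setU ?bnd_simp ?ltW.
  have := tail0 0 (lexx _); rewrite yU integral_setU//=.
  - by rewrite tail0 ?adde0; [move=> ->|exact: ltW].
  - by rewrite -yU; case/integrableP : ih.
  - rewrite disj_set2E; apply/eqP/seteqP; split => // x /=.
    by rewrite !in_itv/= => -[/andP[_ xy]]; rewrite andbT ltNge xy.
have lH : locally_integrable [set: R] H.
  exact: integrable_locally.
have iHy y : mu.-integrable `]0, y] (EFin \o H).
  by apply: (integrableS measurableT) => //; exact: measurable_itv.
apply: ae_imply (@FTC1 R H (BRight 0) iHy lH).
move=> x /= Hx x0; have [//|] := Hx _.
rewrite (_ : (fun x => _) = cst 0); last by apply/funext => y; exact: F0.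
rewrite derive1_cst /H patchE mem_set//= in_itv/= x0// => _ <-.
Qed.

End laplace_injectivity.

(** * Laplace transform of T[p] *)

Section lebesgue_translation.
Context {R : realType}.
Local Notation mu := (@lebesgue_measure R).

Lemma lebesgue_measure_shift (u : R) (A : set R) : measurable A ->
  pushforward mu ((fun x => x - u) : _ -> measurableTypeR R) A = mu A.
Proof.
move=> mA; apply/esym; move: A mA.
have mphi : measurable_fun [set: R] ((fun x => x - u) : _ -> measurableTypeR R).
  exact: measurable_funB.
apply: (@lebesgue_measure_unique R) => _ [[a b]] _ <-.
rewrite /pushforward [X in _ = mu X](_ : _ = `]a + u, b + u]%classic); last first.
  by apply/funext => x /=; rewrite !in_itv/= lerBlDr ltrBrDr.
rewrite !lebesgue_measure_itv/= !lte_fin ltrD2r.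
by case: ifPn => // _; rewrite -!EFinB; congr EFin; ring.
Qed.

Lemma ge0_integral_shift (u : R) (f : R -> \bar R) :
  measurable_fun [set: R] f -> (forall x, 0 <= f x)%E ->
  (\int[mu]_x f (x - u)%R = \int[mu]_x f x)%E.
Proof.
move=> mf f0.
have mphi : measurable_fun [set: measurableTypeR R]
    ((fun x => x - u) : measurableTypeR R -> measurableTypeR R).
  exact: measurable_funB.
have := @ge0_integral_pushforward _ _ (measurableTypeR R) (measurableTypeR R) R
  _ mphi mu setT f.
rewrite preimage_setT => <- //.
by apply: eq_measure_integral => A mA _; exact: lebesgue_measure_shift.
Qed.

(** Allows the density to be changed on a null set inside the factor p (x - u) of the
    convolution. *)
Lemma ae_lebesgue_reflect (P : R -> Prop) (x : R) :
  {ae mu, forall y, P y} -> {ae mu, forall u, P (x - u)}.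
Proof.
move=> [N [mN N0 PN]].
pose f := (fun y => y - - x) : R -> measurableTypeR R.
have mf : measurable (f @^-1` N).
  have mphi : measurable_fun [set: R] f by exact: measurable_funB.
  by rewrite -[_ @^-1` _]setTI; exact: mphi.
exists (-%R @^-1` (f @^-1` N)); split.
- by rewrite -[_ @^-1` _]setTI; apply: oppr_measurable.
- by rewrite -N0 -(lebesgue_measure_shift (- x) mN); exact: lebesgue_measureN.
- by move=> u /= nP; apply: PN => /=; rewrite /f opprK addrC.
Qed.

Lemma integral_expRNM (s v : R) : 0 < s -> 0 < v ->
  (\int[mu]_(u in `[0%R, v]) (expR (- (s * u)))%:E
     = ((1 - expR (- (s * v))) / s)%:E)%E.
Proof.
move=> s0 v0.
have cE : continuous (fun u : R => expR (- (s * u))).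
  move=> u; apply: continuous_comp; last exact: continuous_expR.
  by apply: continuousN; exact: mulrl_continuous.
have dF (u : R) : is_derive u 1 (fun u : R => - expR (- (s * u)) / s) (expR (- (s * u))).
  apply: is_derive_eq; rewrite scaler0 add0r /GRing.scale/= mulr1.
  by field; rewrite gt_eqF.
have cF : continuous (fun u : R => - expR (- (s * u)) / s).
  move=> u; apply/differentiable_continuous/derivable1_diffP.
  by have [] := dF u.
rewrite (@continuous_FTC2 _ _ (fun u => - expR (- (s * u)) / s))//.
- by rewrite -EFinB; congr EFin; rewrite mulr0 oppr0 expR0; field; rewrite gt_eqF.
- exact: continuous_subspaceT.
- split.
  + by move=> u _; have [] := dF u.
  + exact/cvg_at_right_filter/cF.
  + exact/cvg_at_left_filter/cF.
- by move=> u _; rewrite derive1E; have [_ ->] := dF u.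
Qed.

End lebesgue_translation.

Section drm_transform.
Context {R : realType}.
Local Notation mu := (@lebesgue_measure R).
Variable p : R -> R.
Hypothesis mp : measurable_fun [set: R] p.
Hypothesis p_ge0 : forall x, 0 <= p x.
Hypothesis p_supp : forall x, x <= 0 -> p x = 0.

Definition weighted_tail (u : R) : \bar R :=
  (\int[mu]_(v in `[u, +oo[) (v^-1 * p v)%:E)%E.

Let pinv_ge0 (v : R) : 0 <= v^-1 * p v.
Proof.
have [v0|v0] := leP v 0; first by rewrite p_supp// mulr0.
by rewrite mulr_ge0// invr_ge0 ltW.
Qed.

(** The constraint u <= v is absorbed into a function of two variables, so that Tonelli gives both
    the measurability of the tail and the exchange of integrals in its transform. *)
Let kernel (z : R * R) : \bar R :=
  if z.1 <= z.2 then (z.2^-1 * p z.2)%:E else 0%E.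

Let kernel_ge0 z : (0 <= kernel z)%E.
Proof. by rewrite /kernel; case: ifPn => // _; rewrite lee_fin. Qed.

Let measurable_kernel : measurable_fun [set: R * R] kernel.
Proof.
apply: measurable_fun_ifT => //.
  exact: measurable_fun_ler measurable_fst measurable_snd.
apply/measurable_EFinP; apply: measurable_funM.
  exact: (measurableT_comp measurable_invr measurable_snd).
exact: (measurableT_comp mp measurable_snd).
Qed.

Lemma weighted_tail_ge0 u : (0 <= weighted_tail u)%E.
Proof. by apply: integral_ge0 => v _; rewrite lee_fin. Qed.

Let weighted_tailE u : weighted_tail u = (\int[mu]_v kernel (u, v))%E.
Proof.
rewrite /weighted_tail integral_mkcond; apply: eq_integral => v _.
rewrite patchE /kernel/=; case: ifPn.
  by rewrite inE/= in_itv/= andbT => ->.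
by rewrite notin_setE/= in_itv/= andbT => /negP/negbTE ->.
Qed.

Lemma measurable_weighted_tail : measurable_fun [set: R] weighted_tail.
Proof.
have -> : weighted_tail = fubini_F mu kernel.
  by apply/funext => u; rewrite weighted_tailE.
exact: measurable_fun_fubini_tonelli_F.
Qed.

Let g := weighted_tail \_ `]0, +oo[.

Let g_ge0 u : (0 <= g u)%E.
Proof. by rewrite /g patchE; case: ifPn => // _; exact: weighted_tail_ge0. Qed.

Let mg : measurable_fun [set: R] g.
Proof.
apply/(measurable_restrictT _ _).1; first exact: measurable_itv.
exact: measurable_funTS measurable_weighted_tail.
Qed.

(** An integral over the whole line, ready for translation invariance: [g] removes u <= 0 and the
    support of [p] removes u >= x. *)
Let conv (x : R) : \bar R := (\int[mu]_u ((p (x - u))%:E * g u))%E.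

Let drm_operatorE (x : R) : drm_operator p x =
  ((2^-1)%:E * conv x + (2^-1)%:E * weighted_tail x)%E.
Proof.
rewrite /drm_operator -/(weighted_tail _); congr (_ * _ + _)%E.
rewrite -integral_itv_obnd_cbnd; last first.
  apply: emeasurable_funM; last exact: measurable_funTS measurable_weighted_tail.
  apply/measurable_EFinP; apply: (measurableT_comp mp).
  exact: measurable_funB.
rewrite /conv integral_mkcond; apply: eq_integral => u _.
rewrite patchE /g patchE; case: ifPn.
  by rewrite inE/= in_itv/= => /andP[u0 ux]; rewrite mem_set//= in_itv/= u0.
rewrite notin_setE/= in_itv/= => /negP; rewrite negb_and -leNgt -ltNge => /orP[u0|ux].
  by rewrite memNset ?mule0//= in_itv/= andbT; apply/negP; rewrite -leNgt.
by rewrite p_supp ?mul0e// subr_le0 ltW.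
Qed.

Let mconv2 (s : R) : measurable_fun [set: R * R] (fun z : R * R =>
  ((expR (- (s * z.1)))%:E * ((p (z.1 - z.2))%:E * g z.2))%E).
Proof.
apply: emeasurable_funM.
  by apply/measurable_EFinP; exact: measurable_expRNM measurable_fst.
apply: emeasurable_funM; last exact: (measurableT_comp mg measurable_snd).
apply/measurable_EFinP; apply: (measurableT_comp mp).
exact: measurable_funB measurable_fst measurable_snd.
Qed.

Let conv_ge0 x : (0 <= conv x)%E.
Proof. by apply: integral_ge0 => u _; rewrite mule_ge0 ?lee_fin. Qed.

Let mconv : measurable_fun [set: R] conv.
Proof.
pose f (z : R * R) := ((expR (- (0 * z.1)))%:E * ((p (z.1 - z.2))%:E * g z.2))%E.
have -> : conv = fubini_F mu f.
  apply/funext => x; apply: eq_integral => u _.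
  by rewrite /f/= mul0r oppr0 expR0 mul1e.
apply: measurable_fun_fubini_tonelli_F; first exact: mconv2.
by move=> z; rewrite /f mule_ge0 ?mule_ge0 ?lee_fin ?expR_ge0.
Qed.

Lemma drm_operator_ge0 x : (0 <= drm_operator p x)%E.
Proof.
by rewrite drm_operatorE adde_ge0// mule_ge0// ?weighted_tail_ge0// lee_fin invr_ge0.
Qed.

Lemma measurable_drm_operator : measurable_fun [set: R] (drm_operator p).
Proof.
rewrite (_ : drm_operator p = fun x =>
  ((2^-1)%:E * conv x + (2^-1)%:E * weighted_tail x)%E); last first.
  by apply/funext => x; exact: drm_operatorE.
apply: emeasurable_funD; apply: emeasurable_funM => //.
exact: measurable_weighted_tail.
Qed.

Definition laplace (f : R -> \bar R) (s : R) : \bar R :=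
  (\int[mu]_(x in `]0%R, +oo[) ((expR (- (s * x)))%:E * f x))%E.

(** After Tonelli, writing e^(-sx) = e^(-s(x-u)) e^(-su) and translating x by u separates the two
    variables. All factors being nonnegative, the identity holds in the extended reals before any
    transform is known to be finite. *)
Let laplace_conv (s : R) :
  (laplace conv s = laplace (EFin \o p) s * laplace weighted_tail s)%E.
Proof.
have supp0 (x : R) : x \notin (`]0, +oo[%classic : set R) -> x <= 0.
  by rewrite notin_setE/= in_itv/= andbT => /negP; rewrite -leNgt.
have -> : laplace conv s = (\int[mu]_x ((expR (- (s * x)))%:E * conv x))%E.
  rewrite /laplace integral_mkcond; apply: eq_integral => x _.
  rewrite patchE; case: ifPn => // /supp0 x0.
  rewrite /conv integral0_eq ?mule0// => u _; rewrite /g patchE.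
  case: ifPn => [|_]; last by rewrite mule0.
  rewrite inE/= in_itv/= andbT => u0.
  by rewrite p_supp ?mul0e// subr_le0 (le_trans x0)// ltW.
pose F (z : R * R) : \bar R :=
  ((expR (- (s * z.1)))%:E * ((p (z.1 - z.2))%:E * g z.2))%E.
transitivity (\int[mu]_x \int[mu]_u F (x, u))%E.
  apply: eq_integral => x _; rewrite /conv -ge0_integralZl//.
  - apply: emeasurable_funM => //; apply/measurable_EFinP.
    by apply: (measurableT_comp mp); exact: measurable_funB.
  - by move=> u _; rewrite mule_ge0 ?lee_fin.
transitivity (\int[mu]_u \int[mu]_x F (x, u))%E.
  apply: (@fubini_tonelli _ _ _ _ R mu mu F (mconv2 s)).
  by move=> z; rewrite /F mule_ge0 ?mule_ge0 ?lee_fin ?expR_ge0.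
transitivity (\int[mu]_u (laplace (EFin \o p) s * ((expR (- (s * u)))%:E * g u)))%E.
  apply: eq_integral => u _.
  pose f (x : R) : \bar R := ((expR (- (s * x)) * p x)%:E * ((expR (- (s * u)))%:E * g u))%E.
  transitivity (\int[mu]_x f (x - u)%R)%E.
    apply: eq_integral => x _; rewrite /f /F/=.
    rewrite !muleA -!EFinM; congr (EFin _ * _)%E.
    rewrite (_ : - (s * x) = - (s * (x - u)) + - (s * u)) ?expRD; last by ring.
    by ring.
  rewrite ge0_integral_shift.
  - rewrite /f ge0_integralZr//.
    + congr (_ * _)%E; rewrite /laplace [RHS]integral_mkcond.
      apply: eq_integral => x _; rewrite patchE; case: ifPn => // /supp0 x0.
      by rewrite p_supp// mulr0.
    + apply/measurable_EFinP; apply: measurable_funM => //.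
      exact: measurable_expRNM.
    + by move=> x _; rewrite lee_fin mulr_ge0// expR_ge0.
    + by rewrite mule_ge0 ?lee_fin ?expR_ge0.
  - apply: emeasurable_funM => //; apply/measurable_EFinP; apply: measurable_funM => //.
    exact: measurable_expRNM.
  - by move=> x; rewrite /f !mule_ge0 ?lee_fin ?mulr_ge0 ?expR_ge0.
rewrite ge0_integralZl//.
- congr (_ * _)%E; rewrite /laplace [RHS]integral_mkcond; apply: eq_integral => u _.
  by rewrite /g !patchE; case: ifPn => // _; rewrite mule0.
- apply: emeasurable_funM => //; apply/measurable_EFinP.
  exact: measurable_expRNM.
- by move=> u _; rewrite mule_ge0 ?lee_fin ?expR_ge0.
- by apply: integral_ge0 => x _ /=; rewrite -EFinM lee_fin mulr_ge0 ?expR_ge0.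
Qed.

Lemma laplace_drm_operator (s : R) : laplace (drm_operator p) s =
  ((2^-1)%:E * (laplace (EFin \o p) s * laplace weighted_tail s)
   + (2^-1)%:E * laplace weighted_tail s)%E.
Proof.
have h0 : (0 <= (2^-1)%:E :> \bar R)%E by rewrite lee_fin invr_ge0.
have e0 x : (0 <= (expR (- (s * x)))%:E)%E by rewrite lee_fin expR_ge0.
have mE : measurable_fun (`]0, +oo[%classic : set R) (fun x => (expR (- (s * x)))%:E).
  by apply/measurable_EFinP; exact: measurable_expRNM.
have mc : measurable_fun (`]0, +oo[%classic : set R) conv.
  exact: measurable_funTS mconv.
have mt : measurable_fun (`]0, +oo[%classic : set R) weighted_tail.
  exact: measurable_funTS measurable_weighted_tail.
have half f : measurable_fun (`]0, +oo[%classic : set R) f ->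
    (forall x, (0 <= f x)%E) ->
    ((2^-1)%:E * laplace f s = \int[mu]_(x in `]0%R, +oo[)
      ((2^-1)%:E * ((expR (- (s * x)))%:E * f x)))%E.
  move=> mf f0; rewrite /laplace ge0_integralZl//; first exact: emeasurable_funM.
  by move=> x _; rewrite mule_ge0.
rewrite -laplace_conv !half//; last exact: weighted_tail_ge0.
rewrite -ge0_integralD//; first last.
- by apply: emeasurable_funM => //; exact: emeasurable_funM.
- by move=> x _; rewrite !mule_ge0// weighted_tail_ge0.
- by apply: emeasurable_funM => //; exact: emeasurable_funM.
- by move=> x _; rewrite !mule_ge0.
apply: eq_integral => x _; rewrite drm_operatorE ge0_muleDr.
- by rewrite !(muleCA (expR _)%:E).
- by rewrite mule_ge0.
- by rewrite mule_ge0// weighted_tail_ge0.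
Qed.

(** Tonelli on the region 0 < u <= v. The inner integral is left unevaluated because both s > 0,
    where it is (1 - e^(-sv)) / s, and s = 0, where it is v, are used later. *)
Lemma laplace_weighted_tail (s : R) : laplace weighted_tail s =
  (\int[mu]_(v in `]0%R, +oo[)
    ((v^-1 * p v)%:E * \int[mu]_(u in `[0%R, v]) (expR (- (s * u)))%:E))%E.
Proof.
pose G (z : R * R) : \bar R :=
  (if (0 < z.1)%R then (expR (- (s * z.1)))%:E * kernel z else 0)%E.
have e0 x : (0 <= (expR (- (s * x)))%:E)%E by rewrite lee_fin expR_ge0.
have G0 z : (0 <= G z)%E.
  by rewrite /G; case: ifPn => // _; rewrite mule_ge0.
have mG : measurable_fun [set: R * R] G.
  apply: measurable_fun_ifT => //; first exact: measurable_fun_ltr measurable_fst.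
  apply: emeasurable_funM => //; apply/measurable_EFinP.
  exact: measurable_expRNM measurable_fst.
transitivity (\int[mu]_u \int[mu]_v G (u, v))%E.
  rewrite /laplace integral_mkcond; apply: eq_integral => u _.
  rewrite patchE; case: ifPn.
    rewrite inE/= in_itv/= andbT => u0.
    rewrite weighted_tailE -ge0_integralZl//; last exact: measurable_fun_pair2.
    by apply: eq_integral => v _; rewrite /G u0.
  rewrite notin_setE/= in_itv/= andbT => /negP/negbTE u0.
  by rewrite integral0_eq// => v _; rewrite /G u0.
transitivity (\int[mu]_v \int[mu]_u G (u, v))%E.
  exact: (@fubini_tonelli _ _ _ _ R mu mu G).
rewrite [RHS]integral_mkcond; apply: eq_integral => v _.
rewrite patchE; case: ifPn; last first.
  rewrite notin_setE/= in_itv/= andbT => /negP; rewrite -leNgt => v0.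
  rewrite integral0_eq// => u _; rewrite /G /kernel/=; case: ifPn => // u0.
  by case: ifPn; rewrite ?mule0// p_supp// mulr0 mule0.
rewrite inE/= in_itv/= andbT => v0.
rewrite -integral_itv_obnd_cbnd; last first.
  by apply/measurable_EFinP; exact: measurable_expRNM.
rewrite -ge0_integralZl//; last 2 first.
- by apply/measurable_EFinP; exact: measurable_expRNM.
- by rewrite lee_fin.
rewrite [RHS]integral_mkcond; apply: eq_integral => u _.
rewrite patchE /G /kernel/=; case: ifPn => u0.
- case: ifPn => uv.
    by rewrite mem_set/= ?in_itv/= ?u0// muleC.
  by rewrite mule0 memNset//= in_itv/= u0/=; exact/negP.
- by rewrite memNset//= in_itv/= (negbTE u0).
Qed.

End drm_transform.

(** * Differential equation for the transform of an equilibrium *)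

Lemma derive0_oy_cst (R : realType) (h : R -> R) :
  (forall s : R, 0 < s -> is_derive s 1 h 0) ->
  forall s t : R, 0 < s -> 0 < t -> h s = h t.
Proof.
move=> dh s t.
wlog st : s t / s <= t.
  by move=> H s0 t0; case: (leP s t) => [st|/ltW ts]; [exact: H|symmetry; exact: H].
move=> s0 t0.
have [| |c _] := @MVT_segment R h (cst 0) s t st.
- by move=> x; rewrite in_itv/= => /andP[sx _]; apply: dh; exact: lt_trans sx.
- apply: derivable_within_continuous => x; rewrite in_itv/= => /andP[sx _].
  by have [] := dh x (lt_le_trans s0 sx).
by rewrite mul0r => /eqP; rewrite subr_eq0 => /eqP.
Qed.

Section equilibrium_ode.
Context {R : realType}.
Local Notation mu := (@lebesgue_measure R).
Variable p : R -> R.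
Hypothesis mp : measurable_fun [set: R] p.
Hypothesis p_ge0 : forall x, 0 <= p x.
Hypothesis p_supp : forall x, x <= 0 -> p x = 0.
Hypothesis p_int1 : (\int[mu]_(x in `]0%R, +oo[) (p x)%:E = 1)%E.

Lemma density_integrable : mu.-integrable `]0, +oo[ (EFin \o p).
Proof.
apply/integrableP; split.
  by apply/measurable_EFinP; exact: measurable_funTS.
under eq_integral do rewrite /= ger0_norm//.
by rewrite p_int1 ltry.
Qed.

(** If the integral were 0, then k p, hence p, would vanish almost everywhere, against the total
    mass 1. The weights e^(-sx) and 1 - e^(-sx) yield the strict bounds 0 < P < 1. *)
Lemma weighted_density_gt0 (k : R -> R) :
  measurable_fun (`]0, +oo[ : set R) k ->
  (forall x, 0 < x -> 0 < k x <= 1) ->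
  0 < \int[mu]_(x in `]0, +oo[) (k x * p x).
Proof.
move=> mk k01.
have mkp : measurable_fun (`]0, +oo[%classic : set R) (fun x => k x * p x).
  by apply: measurable_funM => //; exact: measurable_funTS.
have kp0 x : `]0, +oo[%classic x -> 0 <= k x * p x.
  by rewrite /= in_itv/= andbT => /k01/andP[/ltW k0 _]; rewrite mulr_ge0.
rewrite lt_neqAle Rintegral_ge0 ?andbT//; apply/eqP => kp_eq0.
have ikp : mu.-integrable `]0, +oo[ (fun x => (k x * p x)%:E).
  apply: integrable_bounded1M => //; last exact: density_integrable.
  move=> x /=; rewrite in_itv/= andbT => /k01/andP[k0 k1].
  by rewrite ger0_norm// ltW.
have kpE : (\int[mu]_(x in `]0%R, +oo[) `|(k x * p x)%:E| = 0)%E.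
  have fkp : (\int[mu]_(x in `]0%R, +oo[) (k x * p x)%:E)%E \is a fin_num.
    exact: integrable_fin_num.
  transitivity ((\int[mu]_(x in `]0, +oo[) (k x * p x))%:E); last by rewrite -kp_eq0.
  rewrite /Rintegral fineK//.
  apply: eq_integral => x; rewrite inE => x0.
  by rewrite /= ger0_norm// kp0.
have mkpE : measurable_fun (`]0, +oo[%classic : set R) (fun x => (k x * p x)%:E).
  exact/measurable_EFinP.
have kp_ae := (ae_eq_integral_abs mu (measurable_itv _) mkpE).1 kpE.
have p_ae : ae_eq mu `]0, +oo[%classic (EFin \o p) (cst 0%E).
  apply: ae_imply kp_ae => x /= kpx x0; move: (kpx x0) => [] /eqP; rewrite mulf_eq0.
  have := x0; rewrite in_itv/= andbT => /k01/andP[k0 _].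
  by rewrite gt_eqF//= => /eqP ->.
have : (\int[mu]_(x in `]0%R, +oo[) (p x)%:E = 0)%E.
  rewrite (ae_eq_integral (cst 0%E))//; first by rewrite integral0.
  by apply/measurable_EFinP; exact: measurable_funTS.
by rewrite p_int1 => /eqP; rewrite onee_eq0.
Qed.

Let P (s : R) := \int[mu]_(x in `]0, +oo[) (expR (- (s * x)) * p x).
Let F (s : R) := \int[mu]_(x in `]0, +oo[) ((1 - expR (- (s * x))) * (x^-1 * p x)).

Let integrable_P (s : R) : 0 <= s ->
  mu.-integrable `]0, +oo[ (fun x => (expR (- (s * x)) * p x)%:E).
Proof.
move=> s0; apply: integrable_bounded1M => //; last exact: density_integrable.
  exact: measurable_expRNM.
move=> x /=; rewrite in_itv/= andbT => /ltW x0.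
by have /andP[e0 e1] := expRNM_itv s0 x0; rewrite ger0_norm// ltW.
Qed.

Lemma laplace_densityE (s : R) : 0 <= s -> laplace (EFin \o p) s = (P s)%:E.
Proof.
move=> s0; rewrite /P /Rintegral fineK//.
by apply: integrable_fin_num => //; exact: integrable_P.
Qed.

Let integrable_F (s : R) : 0 < s ->
  mu.-integrable `]0, +oo[ (fun x => ((1 - expR (- (s * x))) * (x^-1 * p x))%:E).
Proof.
move=> s0.
have -> : (fun x => ((1 - expR (- (s * x))) * (x^-1 * p x))%:E) =
    (fun x => ((1 - expR (- (s * x))) / (s * x) * (s * p x))%:E).
  (* With [x^-1] generalized to [y], only s is divided by, so the identity covers x = 0 as well. *)
  by apply/funext => x; congr EFin; rewrite invfM; set y := x^-1; field; rewrite gt_eqF.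
apply: integrable_bounded1M => //.
- apply: measurable_funM; first by apply: measurable_funB => //; exact: measurable_expRNM.
  apply: (measurable_funTS (f := fun x => (s * x)^-1)).
  by apply: (measurableT_comp measurable_invr); exact: measurable_funM.
- move=> x /=; rewrite in_itv/= andbT => x0.
  have sx0 : 0 < s * x by rewrite mulr_gt0.
  have /andP[e0 e1] := expRNM_itv (ltW s0) (ltW x0).
  rewrite ger0_norm; last by rewrite divr_ge0 ?subr_ge0// ltW.
  by rewrite ler_pdivrMr// mul1r lerBlDr -lerBlDl expR_ge1Dx.
- by apply: (integrableZl _ _ density_integrable).
Qed.

Lemma laplace_tailE (s : R) : 0 < s ->
  laplace (weighted_tail p) s = (F s / s)%:E.
Proof.
move=> s0; rewrite laplace_weighted_tail//.
rewrite mulrC EFinM /F /Rintegral fineK; last by apply: integrable_fin_num => //; exact: integrable_F.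
rewrite -integralZl//; last exact: integrable_F.
apply: eq_integral => x; rewrite inE/= in_itv/= andbT => x0.
by rewrite integral_expRNM// -!EFinM; congr EFin; ring.
Qed.

(** Differentiation under the integral sign: the factor x produced by d/ds cancels 1/x, and what
    remains, e^(-sx) p(x), is dominated by p itself. *)
Let derivable_F (a : R) : 0 < a -> is_derive a 1 F (P a).
Proof.
move=> a0.
pose f (s x : R) := (1 - expR (- (s * x))) * (x^-1 * p x).
have df (s x : R) : 0 < x -> is_derive s 1 (f^~ x) (expR (- (s * x)) * p x).
  move=> x0; apply: is_derive_eq.
  by rewrite /GRing.scale/=; field; rewrite gt_eqF.
have aI : `]0, a + 1[%classic a by rewrite /= in_itv/= a0 ltrDl ltr01.
have i1 s : `]0, a + 1[%classic s -> mu.-integrable `]0, +oo[ (EFin \o f s).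
  by rewrite /= in_itv/= => /andP[s0 _]; exact: integrable_F.
have i2 s y : `]0, a + 1[%classic s -> `]0, +oo[%classic y -> derivable (f^~ y) s 1.
  by rewrite /= !in_itv/= andbT => _ y0; have [] := df s y y0.
have d1 s y : 0 < y -> partial1of2 f s y = expR (- (s * y)) * p y.
  by move=> y0; rewrite partial1of2E; have [_ ->] := df s y y0.
have i3 s y : `]0, a + 1[%classic s -> `]0, +oo[%classic y -> `|partial1of2 f s y| <= p y.
  rewrite /= !in_itv/= andbT => /andP[s0 _] y0; rewrite d1//.
  have /andP[e0 e1] := expRNM_itv (ltW s0) (ltW y0).
  by rewrite ger0_norm ?mulr_ge0// ?ler_piMl// ltW.
have ip := density_integrable.
apply: DeriveDef.
  by apply: (@derivable_under_integral _ _ _ mu f _ _ a 0 (a + 1) aI i1 i2 p _ ip i3).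
rewrite -derive1E.
transitivity (\int[mu]_(y in `]0, +oo[) partial1of2 f a y).
  by apply: (@differentiation_under_integral _ _ _ mu f _ _ a 0 (a + 1) aI i1 i2 p _ ip i3).
by apply: eq_Rintegral => y; rewrite inE/= in_itv/= andbT => y0; exact: d1.
Qed.

(** F and H have the same derivative, and the bounds by 0 and s force both to tend to 0 at 0, so
    they coincide. For p_w this gives F without evaluating an integral whose integrand involves
    x^(-3/2). *)
Lemma laplace_weighted_tail_primitive (H : R -> R) :
  (forall s : R, 0 < s -> is_derive s 1 H (fine (laplace (EFin \o p) s))) ->
  (forall s, 0 < s -> 0 <= H s <= s) ->
  forall s, 0 < s -> laplace (weighted_tail p) s = (H s / s)%:E.
Proof.
move=> dH Hb s s0; rewrite laplace_tailE//; congr ((_ / _)%:E).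
have F_le (t : R) : 0 < t -> 0 <= F t <= t.
  move=> t0; apply/andP; split.
    apply: Rintegral_ge0 => x /=; rewrite in_itv/= andbT => x0.
    have /andP[_ e1] := expRNM_itv (ltW t0) (ltW x0).
    by rewrite mulr_ge0 ?subr_ge0// mulr_ge0// invr_ge0 ltW.
  rewrite -lee_fin /F /Rintegral fineK; last by apply: integrable_fin_num => //; exact: integrable_F.
  have -> : t%:E = (t%:E * \int[mu]_(x in `]0%R, +oo[) (p x)%:E)%E by rewrite p_int1 mule1.
  rewrite -integralZl//; last exact: density_integrable.
  apply: le_integral => //; first exact: integrable_F.
    exact: integrableZl density_integrable.
  move=> x; rewrite inE/= in_itv/= andbT => x0.
  rewrite -EFinM lee_fin mulrA ler_wpM2r// ler_pdivrMr// lerBlDr -lerBlDl.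
  exact: expR_ge1Dx.
have dFH (t : R) : 0 < t -> is_derive t 1 (F - H) 0.
  move=> t0; have dF := derivable_F t0; have dHt := dH t t0.
  apply: is_derive_eq; rewrite laplace_densityE ?ltW//=.
  by rewrite subrr.
apply/eqP; rewrite -subr_eq0 -normr_eq0 eq_le normr_ge0 andbT.
apply/ler_addgt0Pl => e e0; rewrite addr0.
have e20 : 0 < e / 2 by rewrite divr_gt0.
(* The constant difference is evaluated where both functions lie in [0, e / 2]. *)
have -> : F s - H s = F (e / 2) - H (e / 2) := derive0_oy_cst dFH s0 e20.
have := F_le _ e20; have := Hb _ e20; rewrite ler_norml; lra.
Qed.

(** The tail has the mass of v * (p v / v), that is 1. This covers s = 0, which F(s) / s does not,
    while injectivity compares transforms for all s >= 0. *)
Lemma laplace_weighted_tail0 : laplace (weighted_tail p) 0 = 1%E.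
Proof.
rewrite laplace_weighted_tail// -[RHS]p_int1; apply: eq_integral => v.
rewrite inE/= in_itv/= andbT => v0.
have -> : (\int[mu]_(u in `[0%R, v]) (expR (- (0 * u)))%:E = v%:E)%E.
  transitivity (\int[mu]_(u in `[0%R, v]) (cst 1%:E) u)%E.
    by apply: eq_integral => u _; rewrite mul0r oppr0 expR0.
  rewrite integral_cst ?mul1e//= lebesgue_measure_itv/= lte_fin v0.
  by rewrite -EFinD subr0.
by rewrite -EFinM mulrC mulrA mulfV ?mul1r// gt_eqF.
Qed.

Lemma laplace_ode_solution :
  (forall s, 0 < s -> laplace (drm_operator p) s = laplace (EFin \o p) s) ->
  exists2 w, 0 < w & forall s, 0 < s ->
    laplace (EFin \o p) s = ((Num.sqrt (1 + 2 * w * s))^-1)%:E.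
Proof.
move=> Tp.
have ode (s : R) : 0 < s -> (P s + 1) * F s = 2 * s * P s.
  move=> s0; have := Tp s s0; rewrite laplace_drm_operator// laplace_tailE//.
  rewrite laplace_densityE 1?ltW// => -[] eqP.
  rewrite -[in RHS]eqP; field; rewrite gt_eqF//.
have P_gt0 (s : R) : 0 < s -> 0 < P s.
  move=> s0; apply: weighted_density_gt0; first exact: measurable_expRNM.
  by move=> x /ltW x0; apply: expRNM_itv => //; exact: ltW.
have P_lt1 (s : R) : 0 < s -> P s < 1.
  move=> s0; rewrite -subr_gt0.
  have <- : \int[mu]_(x in `]0, +oo[) ((1 - expR (- (s * x))) * p x) = 1 - P s.
    under eq_Rintegral do rewrite mulrBl mul1r.
    rewrite RintegralB//; last 2 first.
    - exact: density_integrable.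
    - by apply: integrable_P; exact: ltW.
    by rewrite [X in X - _]/Rintegral p_int1.
  apply: weighted_density_gt0.
    by apply: measurable_funB => //; exact: measurable_expRNM.
  move=> x x0; apply/andP; split; last by rewrite gerBl expR_ge0.
  by rewrite subr_gt0 -expR0 ltr_expR oppr_lt0 mulr_gt0.
have F_gt0 (s : R) : 0 < s -> 0 < F s.
  move=> s0; have := ode s s0; have := P_gt0 s s0.
  have ? : 0 < P s + 1 by rewrite addr_gt0// P_gt0.
  move=> Ps eqF; rewrite -(pmulr_rgt0 (F s) (_ : 0 < P s + 1))// eqF.
  by rewrite !mulr_gt0.
(* first integral of 2 s F' = (F' + 1) F *)
pose h s := (s - F s) / F s ^+ 2.
have dh (s : R) : 0 < s -> is_derive s 1 h 0.
  move=> s0; have F0 : F s != 0 by rewrite gt_eqF// F_gt0.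
  have dF := derivable_F s0.
  have F20 : F s ^+ 2 != 0 by rewrite expf_neq0.
  have dF2 : is_derive s 1 (fun y => F y ^+ 2) (F s *: P s + F s *: P s).
    have -> : (fun y => F y ^+ 2) = F * F by apply/funext => y; rewrite expr2.
    exact: is_deriveM.
  have dV := @is_deriveV R (fun y => F y ^+ 2) s _ 1 F20 dF2.
  apply: is_derive_eq.
  rewrite /GRing.scale/=; have := ode s s0; move: F0; move: (F s) (P s) => f q f0 e.
  transitivity (((q + 1) * f - 2 * s * q) / f ^+ 3); first by field.
  by rewrite e subrr mul0r.
have hE := derive0_oy_cst dh.
pose c := h 1.
have FE (s : R) : 0 < s -> s = F s + c * F s ^+ 2.
  move=> s0; rewrite /c (hE 1 s)// /h; field; rewrite gt_eqF//; exact: F_gt0.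
(* At s = 1 the equation reads F = 2 P / (P + 1), which is below 1 because P < 1. *)
have c0 : 0 < c.
  rewrite /c /h divr_gt0 ?exprn_gt0 ?F_gt0// subr_gt0.
  have := ode 1 ltr01; have := P_gt0 1 ltr01; have := P_lt1 1 ltr01; have := F_gt0 1 ltr01.
  nra.
exists (2 * c); first by rewrite mulr_gt0//.
move=> s s0; rewrite laplace_densityE 1?ltW//; congr EFin.
have f0 := F_gt0 s s0.
have r0 : 0 < 1 + 2 * c * F s by rewrite addr_gt0// mulr_gt0// mulr_gt0//.
(* Completing the square in s = F + c F^2, with w = 2 c. *)
have -> : 1 + 2 * (2 * c) * s = (1 + 2 * c * F s) ^+ 2.
  by rewrite [in LHS](FE s s0); ring.
rewrite sqrtr_sqr gtr0_norm//.
apply: (mulIf (lt0r_neq0 r0)); rewrite mulVf ?gt_eqF//.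
(* Multiplied by F, the goal P (1 + 2 c F) = 1 is the differential equation with s replaced by F + c
   F^2. *)
apply: (mulIf (lt0r_neq0 f0)).
have := ode s s0; have := FE s s0; move: (F s) (P s) => f q e2 e1.
rewrite e2 in e1; lra.
Qed.

End equilibrium_ode.

(** * The densities p_w *)

Section equilibrium_density.
Context {R : realType}.
Local Notation mu := (@lebesgue_measure R).

Lemma bigcup_itvcc_oy (l r : nat -> R) :
  (forall n, 0 < l n) -> l n @[n --> \oo] --> 0 -> r n @[n --> \oo] --> +oo ->
  \bigcup_n `[l n, r n]%classic = `]0, +oo[%classic.
Proof.
move=> l0 l_cvg r_cvg; apply/seteqP; split => x /=.
  by move=> [n _] /=; rewrite !in_itv/= andbT => /andP[+ _]; exact: lt_le_trans.
rewrite in_itv/= andbT => x0.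
have Hl : \forall n \near \oo, l n <= x.
  by apply: (cvgr_le _ l_cvg).
have Hr : \forall n \near \oo, x <= r n.
  by move/cvgryPge : r_cvg.
near \oo => n; exists n => //=; rewrite in_itv/=; apply/andP; split; near: n => //.
Unshelve. all: by end_near. Qed.

Lemma ge0_cvg_integral_oy (l r : nat -> R) (f : R -> R) :
  (forall n, 0 < l n) -> nonincreasing_seq l -> nondecreasing_seq r ->
  l n @[n --> \oo] --> 0 -> r n @[n --> \oo] --> +oo ->
  measurable_fun [set: R] f -> (forall x, 0 <= f x) ->
  (\int[mu]_(x in `[l n, r n]) (f x)%:E @[n --> \oo] -->
   \int[mu]_(x in `]0%R, +oo[) (f x)%:E)%E.
Proof.
move=> l0 l_ni r_nd l_cvg r_cvg mf f0.
rewrite -(bigcup_itvcc_oy l0 l_cvg r_cvg).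
apply: (@ge0_nondecreasing_set_cvg_integral _ (measurableTypeR R) R
  (fun n => `[l n, r n]%classic) (EFin \o f) mu) => //.
- move=> n m nm; apply/subsetPset; apply: subset_itv; rewrite bnd_simp.
    exact: l_ni.
  exact: r_nd.
- by move=> n; apply/measurable_EFinP; exact: measurable_funTS.
- by move=> n x _; rewrite lee_fin.
Qed.

(* Substitution x = y^2 / b, carried out on the compact intervals [1/n, n] since the
   integrand is singular at 0 and the derivative of y^2 / b diverges at +oo. *)
Lemma integral_expRNM_sqrtV (b : R) : 0 < b ->
  (\int[mu]_(x in `]0%R, +oo[) ((Num.sqrt x)^-1 * expR (- (b * x)))%:E
    = (Num.sqrt (pi / b))%:E)%E.
Proof.
move=> b0.
pose l (n : nat) : R := n.+1%:R^-1.
pose r (n : nat) : R := n.+1%:R.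
pose F (y : R) := y ^+ 2 / b.
pose G (x : R) := (Num.sqrt x)^-1 * expR (- (b * x)).
have l0 n : 0 < l n by rewrite invr_gt0 ltr0n.
have r0 n : 0 < r n by rewrite ltr0n.
have lr n : l n <= r n.
  by rewrite /l /r (@le_trans _ _ 1)// ?invf_le1 ?ler1n ?ltr0n.
have F_homo (x y : R) : 0 < x -> x <= y -> F x <= F y.
  by move=> x0 xy; rewrite ler_pM2r ?invr_gt0// ler_pXn2r ?nnegrE// ltW// (lt_le_trans x0).
have l_ni : nonincreasing_seq l.
  by move=> n m nm; rewrite lef_pV2 ?posrE ?ltr0n// ler_nat ltnS.
have r_nd : nondecreasing_seq r by move=> n m nm; rewrite ler_nat ltnS.
have l_cvg : l n @[n --> \oo] --> 0 by exact: cvg_harmonic.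
have r_cvg : r n @[n --> \oo] --> +oo.
  by rewrite (cvg_shiftS (fun n => n%:R : R)); exact: cvgr_idn.
have F0 n : 0 < F (l n) by rewrite divr_gt0// exprn_gt0.
have Fl_ni : nonincreasing_seq (F \o l).
  by move=> n m nm; exact/F_homo/l_ni.
have Fr_nd : nondecreasing_seq (F \o r).
  by move=> n m nm; exact/F_homo/r_nd.
have Fl_cvg : (F \o l) n @[n --> \oo] --> 0.
  rewrite (_ : 0 = (0 * 0) / b); last by rewrite !mul0r.
  by apply: cvgMr_tmp; rewrite /comp; under eq_fun do rewrite expr2; exact: cvgM.
have Fr_cvg : (F \o r) n @[n --> \oo] --> +oo.
  apply: (@ger_cvgy _ _ _ _ (fun n => r n / b)).
    apply: nearW => n; rewrite ler_pM2r ?invr_gt0// expr2.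
    by apply: ler_peMr; [exact: ltW|rewrite /r ler1n].
  apply/cvgryPge => A; move/cvgryPge : r_cvg => /(_ (A * b)).
  by apply: filterS => n; rewrite ler_pdivlMr.
have G0 x : 0 <= G x by rewrite mulr_ge0 ?invr_ge0 ?sqrtr_ge0 ?expR_ge0.
have mG : measurable_fun [set: R] G.
  apply: measurable_funM; last exact: measurable_expRNM.
  apply: (measurableT_comp measurable_invr).
  exact: continuous_measurable_fun (@sqrt_continuous R).
have dF (y : R) : is_derive y 1 F (2 * y / b).
  have -> : F = b^-1 *: (id * id).
    by apply/funext => z; rewrite /F/= expr2 mulrC.
  apply: is_derive_eq; rewrite /GRing.scale/=; ring.
have F'E : derive1 F = fun y => 2 * y / b.
  by apply/funext => y; rewrite derive1E; have [_ ->] := dF y.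
have cF' : continuous (derive1 F).
  rewrite F'E => y; apply: cvgMr_tmp; exact: mulrl_continuous.
have cF : continuous F.
  by move=> y; apply/differentiable_continuous/derivable1_diffP; have [] := dF y.
(* Under x = y^2 / b one has dx / sqrt x = (2 / sqrt b) dy: the singularity cancels and the Gaussian
   e^(-y^2) is left. *)
have subst n : (\int[mu]_(x in `[F (l n), F (r n)]) (G x)%:E =
    (2 / Num.sqrt b)%:E * \int[mu]_(y in `[l n, r n]) (gauss_fun y)%:E)%E.
  rewrite integration_by_substitution_increasing//.
  - rewrite -ge0_integralZl//.
    + apply: eq_integral => y; rewrite inE/= in_itv/= => /andP[ly _].
      have y0 : 0 < y := lt_le_trans (l0 n) ly.
      rewrite -EFinM; congr EFin; rewrite /G F'E /F /gauss_fun fctE/=.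
      rewrite sqrtrM ?sqr_ge0// sqrtr_sqr gtr0_norm// sqrtrV ?ltW//.
      rewrite (_ : b * (y ^+ 2 / b) = y ^+ 2); last by field; rewrite gt_eqF.
      rewrite invfM invrK -[in 2 * y / b](sqr_sqrtr (ltW b0)).
      by field; rewrite !gt_eqF// sqrtr_gt0.
    + by apply/measurable_EFinP; exact: measurable_funTS (measurable_gauss_fun).
    + by move=> y _; rewrite lee_fin gauss_fun_ge0.
  - move=> x y; rewrite !in_itv/= => /andP[lx _] /andP[ly _] xy.
    rewrite ltr_pM2r ?invr_gt0// ltr_pXn2r ?nnegrE//.
      exact: le_trans (ltW (l0 n)) lx.
    exact: le_trans (ltW (l0 n)) ly.
  - by apply/cvg_ex; exists (derive1 F (l n)); exact: cvg_at_right_filter (cF' _).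
  - by apply/cvg_ex; exists (derive1 F (r n)); exact: cvg_at_left_filter (cF' _).
  - split.
    + by move=> y _; have [] := dF y.
    + exact: cvg_at_right_filter (cF _).
    + exact: cvg_at_left_filter (cF _).
  - apply: continuous_in_subspaceT => x; rewrite inE/= in_itv/= => /andP[Fx _].
    have x0 : 0 < x := lt_le_trans (F0 n) Fx.
    apply: cvgM.
      apply: cvgV; first by rewrite gt_eqF// sqrtr_gt0.
      exact: sqrt_continuous.
    apply: continuous_comp; last exact: continuous_expR.
    by apply: continuousN; exact: mulrl_continuous.
have cvgG := ge0_cvg_integral_oy F0 Fl_ni Fr_nd Fl_cvg Fr_cvg mG G0.
have cvgg := ge0_cvg_integral_oy l0 l_ni r_nd l_cvg r_cvg (@measurable_gauss_fun R) (@gauss_fun_ge0 R).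
have gE : (\int[mu]_(x in `]0%R, +oo[) (gauss_fun x)%:E = (Num.sqrt pi / 2)%:E)%E.
  rewrite integral_itv_obnd_cbnd; first exact: integral0y_gauss.
  by apply/measurable_EFinP; exact: measurable_funTS measurable_gauss_fun.
rewrite gE in cvgg.
have : (\int[mu]_(x in `[(F \o l) n, (F \o r) n]) (G x)%:E @[n --> \oo] -->
   (2 / Num.sqrt b)%:E * (Num.sqrt pi / 2)%:E)%E.
  under eq_fun do rewrite /comp subst.
  exact: cvgeZl.
move/(cvg_unique _ cvgG) => ->//.
rewrite -EFinM; congr EFin; rewrite sqrtrM ?pi_ge0// sqrtrV ?ltW//.
by field; rewrite gt_eqF// sqrtr_gt0.
Unshelve. all: by end_near. Qed.

Lemma drm_density_ge0 (w x : R) : 0 <= drm_equilibrium_density w x.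
Proof. by rewrite mulr_ge0 ?invr_ge0 ?sqrtr_ge0 ?expR_ge0. Qed.

(** The square root of a nonpositive number is 0 and so is the inverse of 0; the closed formula thus
    vanishes on the left half-line without any explicit cut-off. *)
Lemma drm_density_le0 (w x : R) : 0 < w -> x <= 0 ->
  drm_equilibrium_density w x = 0.
Proof.
move=> w0 x0; rewrite /drm_equilibrium_density ler0_sqrtr ?invr0 ?mul0r//.
by rewrite mulr_ge0_le0// !mulr_ge0 ?pi_ge0// ltW.
Qed.

Lemma measurable_drm_density (w : R) :
  measurable_fun [set: R] (drm_equilibrium_density w).
Proof.
apply: measurable_funM.
  apply: (measurableT_comp measurable_invr).
  apply: measurableT_comp; first exact: continuous_measurable_fun (@sqrt_continuous R).
  exact: mulrl_measurable.
apply: measurableT_comp => //; apply: measurable_funN.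
exact: mulrr_measurable.
Qed.

Lemma laplace_drm_density (w s : R) : 0 < w -> 0 <= s ->
  laplace (EFin \o drm_equilibrium_density w) s
    = ((Num.sqrt (1 + 2 * w * s))^-1)%:E.
Proof.
move=> w0 s0; pose b := s + (2 * w)^-1.
have w20 : 0 < 2 * w by rewrite mulr_gt0.
have b0 : 0 < b by rewrite ltr_wpDl// invr_gt0.
have pi0 := @pi_gt0 R.
have q0 : 0 < 2 * w * pi by rewrite mulr_gt0.
rewrite (_ : 1 + 2 * w * s = 2 * w * b); last first.
  by rewrite /b; field; rewrite gt_eqF.
transitivity (((Num.sqrt (2 * w * pi))^-1)%:E *
    \int[mu]_(x in `]0%R, +oo[) ((Num.sqrt x)^-1 * expR (- (b * x)))%:E)%E.
  rewrite -ge0_integralZl//.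
  - apply: eq_integral => x; rewrite inE/= in_itv/= andbT => x0.
    rewrite -!EFinM; congr EFin; rewrite /drm_equilibrium_density.
    rewrite sqrtrM ?ltW// invfM.
    rewrite (_ : - (b * x) = - (s * x) + - (x / (2 * w))) ?expRD; first by ring.
    by rewrite /b mulrDl opprD [x / _]mulrC.
  - apply/measurable_EFinP; apply: measurable_funM; last exact: measurable_expRNM.
    apply: measurable_funTS; apply: (measurableT_comp measurable_invr).
    exact: continuous_measurable_fun (@sqrt_continuous R).
rewrite integral_expRNM_sqrtV// -EFinM; congr EFin.
rewrite (sqrtrM pi (ltW w20)) (sqrtrM b^-1 (ltW pi0)) (sqrtrM b (ltW w20)) sqrtrV ?ltW//.
by field; rewrite !gt_eqF ?sqrtr_gt0.
Qed.

Lemma drm_density_int1 (w : R) : 0 < w ->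
  (\int[mu]_(x in `]0%R, +oo[) (drm_equilibrium_density w x)%:E = 1)%E.
Proof.
move=> w0; have := laplace_drm_density w0 (lexx 0).
rewrite mulr0 addr0 sqrtr1 invr1 => <-; apply: eq_integral => x _.
by rewrite mul0r oppr0 expR0 mul1e.
Qed.

(** Both bounds come from 1 + t <= e^t, at t = s x for the lower one and t = - s x for the upper
    one. They squeeze the difference quotient to x as s tends to 0. *)
Lemma diffquot_expRN_le (s x : R) : 0 < s -> 0 <= x ->
  x / (1 + s * x) <= (1 - expR (- (s * x))) / s <= x.
Proof.
move=> s0 x0; have sx0 : 0 <= s * x by rewrite mulr_ge0// ltW.
have d0 : 0 < 1 + s * x by rewrite ltr_wpDr.
apply/andP; split; last first.
  rewrite ler_pdivrMr// lerBlDr -lerBlDl mulrC; exact: expR_ge1Dx.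
rewrite ler_pdivlMr// mulrAC ler_pdivrMr// mulrBl mul1r.
have : expR (- (s * x)) * (1 + s * x) <= 1.
  rewrite expRN ler_pdivrMl ?expR_gt0// mulr1; exact: expR_ge1Dx.
by lra.
Qed.

(* The mean is the monotone limit of (1 - P(s)) / s along s = 2^-n. *)
Lemma mean_drm_density (w : R) : 0 < w ->
  mean_wealth (drm_equilibrium_density w) = w%:E.
Proof.
move=> w0; set p := drm_equilibrium_density w.
have mp : measurable_fun [set: R] p := measurable_drm_density w.
have p0 x : 0 <= p x := drm_density_ge0 w x.
pose s (n : nat) : R := 2^-1 ^+ n.
have s_gt0 n : 0 < s n by rewrite exprn_gt0// invr_gt0.
have s_cvg : s n @[n --> \oo] --> (0 : R).
  by apply: cvg_expr; rewrite ger0_norm ?invr_ge0//; lra.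
pose f (n : nat) (x : R) := (1 - expR (- (s n * x))) / s n * p x.
have mf n : measurable_fun (`]0, +oo[ : set R) (f n).
  apply: measurable_funM; last exact: measurable_funTS.
  apply: measurable_funM => //; apply: measurable_funB => //.
  exact: measurable_expRNM.
have f0 n x : `]0, +oo[%classic x -> (0 <= (f n x)%:E)%E.
  rewrite /= in_itv/= andbT => /ltW x0; have /andP[_ e1] := expRNM_itv (ltW (s_gt0 n)) x0.
  by rewrite lee_fin mulr_ge0// divr_ge0 ?subr_ge0// ltW.
have f_nd x : `]0, +oo[%classic x -> nondecreasing_seq (fun n => (f n x)%:E).
  move=> x0; apply/nondecreasing_seqP => n; rewrite lee_fin ler_wpM2r//.
  (* Halving s reduces monotonicity to (1 - e^(-t))^2 >= 0 with t = s n.+1 * x. *)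
  have -> : s n = 2 * s n.+1 by rewrite /s exprS mulrA mulfV ?mul1r.
  rewrite ler_pdivrMr ?mulr_gt0// (_ : 2 * _ * x = s n.+1 * x + s n.+1 * x); last by ring.
  rewrite opprD expRD mulrCA divfK ?gt_eqF//.
  by have := sqr_ge0 (1 - expR (- (s n.+1 * x))); lra.
have f_cvg x : `]0, +oo[%classic x -> (fun n => (f n x)%:E) @ \oo --> (x * p x)%:E.
  rewrite /= in_itv/= andbT => x0; apply: cvg_EFin; first exact: nearW.
  apply: cvgMr_tmp.
  apply: (@squeeze_cvgr _ _ _ _ (fun n => x / (1 + s n * x)) (cst x)).
  - by apply: nearW => n; apply: diffquot_expRN_le => //; exact: ltW.
  - rewrite -[X in _ --> X]divr1; apply: cvgMl_tmp.
    apply: cvgV; first by rewrite oner_eq0.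
    rewrite -[X in _ --> X](_ : 1 + 0 * x = 1); last by rewrite mul0r addr0.
    by apply: cvgD; [exact: cvg_cst|exact: cvgMr_tmp].
  - exact: cvg_cst.
have mfE n : measurable_fun (`]0, +oo[ : set R) (fun x => (f n x)%:E).
  exact/measurable_EFinP.
have If_cvg := @cvg_monotone_convergence _ (measurableTypeR R) R mu _ (measurable_itv `]0, +oo[) _
  mfE f0 f_nd.
have meanE : mean_wealth p = (\int[mu]_(x in `]0%R, +oo[) limn (fun n => (f n x)%:E))%E.
  rewrite /mean_wealth -integral_itv_obnd_cbnd; last first.
    by apply/measurable_EFinP; apply: measurable_funM => //; exact: measurable_funTS.
  apply: eq_integral => x; rewrite inE => x0.
  by rewrite (cvg_lim _ (f_cvg x x0)).
rewrite -meanE in If_cvg.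
have ip := density_integrable mp p0 (drm_density_int1 w0).
pose r (n : nat) : R := Num.sqrt (1 + 2 * w * s n).
have r_gt0 n : 0 < r n by rewrite sqrtr_gt0 addr_gt0// mulr_gt0// mulr_gt0.
(* This is (1 - 1 / r) / s rationalized by r^2 - 1 = 2 w s, so that letting r tend to 1 gives w
   directly. *)
have fE n : (\int[mu]_(x in `]0%R, +oo[) (f n x)%:E = (2 * w / (r n * (r n + 1)))%:E)%E.
  have ie : mu.-integrable `]0, +oo[ (fun x => (expR (- (s n * x)) * p x)%:E).
    apply: integrable_bounded1M => //; first exact: measurable_expRNM.
    move=> x /=; rewrite in_itv/= andbT => /ltW x0.
    by have /andP[e0 e1] := expRNM_itv (ltW (s_gt0 n)) x0; rewrite ger0_norm// ltW.
  transitivity (((s n)^-1)%:E * \int[mu]_(x in `]0%R, +oo[)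
     ((p x)%:E - (expR (- (s n * x)) * p x)%:E))%E.
    rewrite -integralZl//; last exact: integrableB.
    by apply: eq_integral => x _; rewrite -EFinB -EFinM; congr EFin; rewrite /f; ring.
  rewrite integralB_EFin// drm_density_int1//.
  have -> : (\int[mu]_(x in `]0%R, +oo[) (expR (- (s n * x)) * p x)%:E =
      ((r n)^-1)%:E)%E := laplace_drm_density w0 (ltW (s_gt0 n)).
  rewrite -EFinB -EFinM; congr EFin.
  have r2 : r n ^+ 2 = 1 + 2 * w * s n.
    by rewrite sqr_sqrtr// addr_ge0// !mulr_ge0// ltW.
  rewrite -/(r n); have rn0 := r_gt0 n; have sn0 := s_gt0 n.
  apply: (mulIf (lt0r_neq0 sn0)); apply: (mulIf (lt0r_neq0 rn0)).
  apply: (mulIf (lt0r_neq0 (addr_gt0 rn0 ltr01))).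
  transitivity (r n ^+ 2 - 1); first by field; rewrite !gt_eqF.
  by rewrite r2; field; rewrite !gt_eqF// addr_gt0.
have r_cvg : r n @[n --> \oo] --> (1 : R).
  rewrite -[X in _ --> X]sqrtr1; apply: continuous_cvg; first exact: sqrt_continuous.
  rewrite -[X in _ --> X](_ : 1 + 2 * w * 0 = 1); last by rewrite mulr0 addr0.
  by apply: cvgD; [exact: cvg_cst|exact: cvgMl_tmp].
have : (\int[mu]_(x in `]0%R, +oo[) (f n x)%:E @[n --> \oo] --> w%:E)%E.
  under eq_fun do rewrite fE.
  apply: cvg_EFin; first exact: nearW.
  rewrite -[X in _ --> X](_ : 2 * w / (1 * (1 + 1)) = w); last by field.
  apply: cvgMl_tmp; apply: cvgV; first by rewrite mul1r gt_eqF.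
  by apply: cvgM => //; apply: cvgD => //; exact: cvg_cst.
by move/(cvg_unique _ If_cvg) => ->.
Qed.

End equilibrium_density.

(** * Equilibria *)

Section equilibria.
Context {R : realType}.
Local Notation mu := (@lebesgue_measure R).

Lemma ae_neq (a : R) : {ae mu, forall x, x != a}.
Proof.
exists [set a]; split => //; first exact: lebesgue_measure_set1.
by move=> x /= /negP; rewrite negbK => /eqP.
Qed.

Lemma laplace_inj (f g : R -> R) :
  mu.-integrable `]0, +oo[ (EFin \o f) -> mu.-integrable `]0, +oo[ (EFin \o g) ->
  (forall s, 0 <= s -> laplace (EFin \o f) s = laplace (EFin \o g) s) ->
  {ae mu, forall x, 0 < x -> f x = g x}.
Proof.
move=> fi gi fg.
have ib (h : R -> R) (s : R) : 0 <= s -> mu.-integrable `]0, +oo[ (EFin \o h) ->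
    mu.-integrable `]0, +oo[ (fun x => (expR (- (s * x)) * h x)%:E).
  move=> s0; apply: integrable_bounded1M => //; first exact: measurable_expRNM.
  move=> x /=; rewrite in_itv/= andbT => /ltW x0.
  by have /andP[e0 e1] := expRNM_itv s0 x0; rewrite ger0_norm// ltW.
have : {ae mu, forall x, 0 < x -> f x - g x = 0}.
  apply: laplace_eq0_ae.
    rewrite (_ : _ \o _ = (fun x => (f x)%:E - (g x)%:E)%E)//.
    exact: integrableB.
  move=> s s0; under eq_integral do rewrite mulrBr EFinB.
  rewrite integralB_EFin//; [|exact: ib|exact: ib].
  have -> : (\int[mu]_(x in `]0%R, +oo[) (expR (- (s * x)) * f x)%:E =
    \int[mu]_(x in `]0%R, +oo[) (expR (- (s * x)) * g x)%:E)%E := fg s s0.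
  by rewrite subee//; apply: integrable_fin_num => //; exact: ib.
by apply: ae_imply => x + x0 => /(_ x0)/eqP; rewrite subr_eq0 => /eqP.
Qed.

Lemma weighted_tail_ae_eq (p q : R -> R) (u : R) :
  measurable_fun (`[0, +oo[ : set R) p -> measurable_fun (`[0, +oo[ : set R) q ->
  {ae mu, forall x, 0 < x -> p x = q x} -> 0 <= u ->
  weighted_tail p u = weighted_tail q u.
Proof.
move=> mp mq pq u0.
have sub : (`[u, +oo[%classic : set R) `<=` `[0, +oo[%classic by apply: subset_itvr; rewrite bnd_simp.
have mw (h : R -> R) : measurable_fun (`[0, +oo[ : set R) h ->
    measurable_fun (`[u, +oo[ : set R) (fun v => (v^-1 * h v)%:E).
  move=> mh; apply/measurable_EFinP; apply: measurable_funM.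
    exact: measurable_funTS measurable_invr.
  exact: measurable_funS mh.
apply: ae_eq_integral => //; [exact: mw|exact: mw|].
apply: ae_imply pq => x pqx; rewrite /= in_itv/= andbT => ux.
(* At 0 both integrands vanish because 0^-1 = 0, so agreement for x > 0 suffices. *)
have := le_trans u0 ux; rewrite le_eqVlt => /predU1P[<-|x0].
  by rewrite invr0 !mul0r.
by rewrite pqx.
Qed.

(** The tails agree at every u >= 0 and the factors p (x - u) for almost every u, the point u = x
    being discarded because agreement is given only at positive arguments. The tails are exchanged
    before the factors, so that measurability of a tail is asked of [q] alone. *)
Lemma drm_operator_ae_eq (p q : R -> R) (x : R) :
  measurable_fun (`[0, +oo[ : set R) p ->
  measurable_fun [set: R] q -> (forall x, 0 <= q x) -> (forall x, x <= 0 -> q x = 0) ->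
  {ae mu, forall x, 0 < x -> p x = q x} -> 0 < x ->
  drm_operator p x = drm_operator q x.
Proof.
move=> mp mq q0 q_supp pq x0.
have mq' : measurable_fun (`[0, +oo[ : set R) q by exact: measurable_funTS.
rewrite /drm_operator -/(weighted_tail p x) -/(weighted_tail q x).
rewrite (weighted_tail_ae_eq mp mq' pq (ltW x0)); congr (_ * _ + _)%E.
transitivity (\int[mu]_(u in `[0%R, x]) ((p (x - u)%R)%:E * weighted_tail q u))%E.
  apply: eq_integral => u; rewrite inE/= in_itv/= => /andP[u0 _].
  by rewrite -(weighted_tail_ae_eq mp mq' pq u0).
have mt : measurable_fun (`[0, x]%classic : set R) (weighted_tail q).
  exact: measurable_funTS (measurable_weighted_tail mq q0 q_supp).
apply: ae_eq_integral => //.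
- apply: emeasurable_funM => //; apply/measurable_EFinP.
  apply: (@measurable_comp _ _ _ _ _ _ (`[0, +oo[%classic : set R)) => //.
    move=> _ [u /= + <-]; rewrite !in_itv/= => /andP[_ ux].
    by rewrite subr_ge0 ux.
  exact: measurable_funB.
- apply: emeasurable_funM => //; apply/measurable_EFinP.
  by apply: (measurableT_comp mq); exact: measurable_funB.
- apply: ae_imply2 (ae_neq x) (ae_lebesgue_reflect x pq) => u ux pqu.
  rewrite /= in_itv/= => /andP[_ u_le]; rewrite pqu// subr_gt0 lt_neqAle u_le andbT.
  exact: ux.
Qed.

Lemma equilibrium_ae_eq (p q : R -> R) :
  measurable_fun (`[0, +oo[ : set R) p ->
  measurable_fun [set: R] q -> (forall x, 0 <= q x) -> (forall x, x <= 0 -> q x = 0) ->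
  {ae mu, forall x, 0 < x -> p x = q x} ->
  is_equilibrium q -> is_equilibrium p.
Proof.
move=> mp mq q0 q_supp pq [[qi qge0 q1] Tq].
have mq' : measurable_fun (`[0, +oo[ : set R) q by exact: measurable_funTS.
have pq0 : {ae mu, forall x, 0 <= x -> p x = q x}.
  apply: ae_imply2 (ae_neq 0) pq => x xn0 pqx x0.
  by apply: pqx; rewrite lt_neqAle eq_sym xn0.
have norm1 : (\int[mu]_(x in `[0%R, +oo[) (`|p x|%R)%:E = 1)%E.
  rewrite -q1; apply: ae_eq_integral => //.
  - by apply/measurable_EFinP; exact: measurableT_comp.
  - by apply/measurable_EFinP; exact: measurableT_comp.
  - by apply: ae_imply pq0 => x pqx; rewrite /= in_itv/= andbT => x0; rewrite pqx.
split; first split => //.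
- apply/integrableP; split; first exact/measurable_EFinP.
  by under eq_integral do rewrite /=; rewrite norm1 ltry.
- by apply: ae_imply pq0 => x pqx x0; rewrite pqx.
- apply: (ae_imply2 _ pq Tq) => x pqx Tqx x0.
  by rewrite (drm_operator_ae_eq mp mq q0 q_supp pq x0) Tqx// pqx.
Qed.

Lemma equilibrium_ae_drm_density (p : R -> R) :
  measurable_fun (`[0, +oo[ : set R) p -> is_equilibrium p ->
  exists2 w : R, 0 < w &
    {ae mu, forall x, 0 < x -> p x = drm_equilibrium_density w x}.
Proof.
move=> mp [[pi p_ge0 p1] Tp].
(* A representative meeting everywhere the conditions of the transform computations: Borel on the
   line, nonnegative, and zero on the left half-line. *)
pose q := (fun x => `|p x|) \_ `]0, +oo[.
have mp' : measurable_fun (`]0, +oo[ : set R) (fun x => `|p x|).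
  apply: measurableT_comp => //; apply: measurable_funS mp => //.
  by apply: subset_itvr; rewrite bnd_simp.
have mq : measurable_fun [set: R] q.
  by apply/(measurable_restrictT _ _).1.
have q_ge0 x : 0 <= q x by rewrite /q patchE; case: ifPn.
have q_supp x : x <= 0 -> q x = 0.
  by move=> x0; rewrite /q patchE memNset//= in_itv/= andbT; apply/negP; rewrite -leNgt.
have q_pos x : 0 < x -> q x = `|p x|.
  by move=> x0; rewrite /q patchE mem_set//= in_itv/= x0.
have q1 : (\int[mu]_(x in `]0%R, +oo[) (q x)%:E = 1)%E.
  rewrite -p1 -integral_itv_obnd_cbnd; last exact/measurable_EFinP.
  by apply: eq_integral => x; rewrite inE/= in_itv/= andbT => x0; rewrite q_pos.
have pq : {ae mu, forall x, 0 < x -> p x = q x}.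
  by apply: ae_imply p_ge0 => x p0 x0; rewrite q_pos// ger0_norm// p0// ltW.
have [|w w0 wP] := laplace_ode_solution mq q_ge0 q_supp q1.
  move=> s s0; apply: ae_eq_integral => //.
  - apply: emeasurable_funM; first by apply/measurable_EFinP; exact: measurable_expRNM.
    exact: measurable_funTS (measurable_drm_operator mq q_ge0 q_supp).
  - apply: emeasurable_funM; first by apply/measurable_EFinP; exact: measurable_expRNM.
    by apply/measurable_EFinP; exact: measurable_funTS.
  - apply: (ae_imply2 _ pq Tp) => x pqx Tpx; rewrite /= in_itv/= andbT => x0.
    by rewrite -(drm_operator_ae_eq mp mq q_ge0 q_supp pq x0) Tpx// pqx.
exists w => //.
have : {ae mu, forall x, 0 < x -> q x = drm_equilibrium_density w x}.
  apply: laplace_inj.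
  - exact: density_integrable.
  - by apply: density_integrable; [exact: measurable_drm_density|exact: drm_density_ge0|exact: drm_density_int1].
  move=> s; rewrite le_eqVlt => /predU1P[<-|s0]; last first.
    by rewrite wP// laplace_drm_density// ltW.
  rewrite laplace_drm_density// mulr0 addr0 sqrtr1 invr1 -[RHS]q1.
  by apply: eq_integral => x _; rewrite mul0r oppr0 expR0 mul1e.
by apply: ae_imply2 pq => x pqx qx x0; rewrite pqx// qx.
Qed.

(** H is the nonnegative root F of s = F + (w / 2) F^2, equivalently the primitive of (1 + 2 w
    s)^(-1/2) vanishing at 0. The bound H <= s is sqrt (1 + 2 w s) <= 1 + w s. *)
Lemma laplace_tail_drm_density (w s : R) : 0 < w -> 0 < s ->
  laplace (weighted_tail (drm_equilibrium_density w)) s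
    = ((Num.sqrt (1 + 2 * w * s) - 1) / w / s)%:E.
Proof.
move=> w0.
pose H (s : R) := (Num.sqrt (1 + 2 * w * s) - 1) / w.
apply: (@laplace_weighted_tail_primitive R _ (measurable_drm_density w)
  (drm_density_ge0 w) (fun x => @drm_density_le0 R w x w0) (drm_density_int1 w0) H).
- move=> t t0; rewrite laplace_drm_density ?ltW//=.
  have d0 : 0 < 1 + 2 * w * t by rewrite addr_gt0// mulr_gt0// mulr_gt0.
  have dl : is_derive t 1 (fun y : R => 1 + 2 * w * y) (2 * w).
    by apply: is_derive_eq; rewrite /GRing.scale/=; ring.
  have dr := @is_derive1_comp R Num.sqrt (fun y => 1 + 2 * w * y) t _ _
    (is_derive1_sqrt d0) dl.
  have -> : H = w^-1 *: ((Num.sqrt \o (fun y => 1 + 2 * w * y)) - cst 1).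
    by apply/funext => y; rewrite /H mulrC.
  apply: is_derive_eq; rewrite subr0 /GRing.scale/=.
  by field; rewrite !gt_eqF// sqrtr_gt0.
- move=> t t0; have wt0 : 0 < w * t by rewrite mulr_gt0.
  have r1 : 1 <= Num.sqrt (1 + 2 * w * t).
    by rewrite -[leLHS]sqrtr1 ler_wsqrtr// lerDl mulr_ge0 ?mulr_ge0// ltW.
  apply/andP; split; first by rewrite divr_ge0 ?subr_ge0// ltW.
  rewrite ler_pdivrMr// lerBlDr -[leRHS]ger0_norm; last by rewrite addr_ge0// mulr_ge0// ltW.
  rewrite -sqrtr_sqr ler_wsqrtr//.
  have := sqr_ge0 (w * t); nra.
Qed.

Lemma drm_density_equilibrium (w : R) : 0 < w ->
  is_equilibrium (drm_equilibrium_density w).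
Proof.
move=> w0; set p := drm_equilibrium_density w.
have mp : measurable_fun [set: R] p := measurable_drm_density w.
have p_ge0 := drm_density_ge0 w : forall x, 0 <= p x.
have p_supp x : x <= 0 -> p x = 0 by exact: drm_density_le0.
have p1 : (\int[mu]_(x in `]0%R, +oo[) (p x)%:E = 1)%E := drm_density_int1 w0.
have ip := density_integrable mp p_ge0 p1.
have p1c : (\int[mu]_(x in `[0%R, +oo[) (`|p x|%R)%:E = 1)%E.
  rewrite -p1 -integral_itv_obnd_cbnd.
    by apply: eq_integral => x _; rewrite ger0_norm.
  by apply/measurable_EFinP; apply: measurableT_comp => //; exact: measurable_funTS.
split; first split => //.
- apply/integrableP; split.
    by apply/measurable_EFinP; exact: measurable_funTS.
  by rewrite p1c ltry.
- exact: aeW.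
have LT (s : R) : 0 <= s -> laplace (drm_operator p) s = laplace (EFin \o p) s.
  rewrite laplace_drm_operator// le_eqVlt => /predU1P[<-|s0].
    rewrite laplace_weighted_tail0// laplace_drm_density// mulr0 addr0 sqrtr1 invr1.
    by rewrite !mule1 -EFinD; congr EFin; field.
  rewrite laplace_tail_drm_density// laplace_drm_density ?ltW//.
  have d0 : 0 < 1 + 2 * w * s by rewrite addr_gt0// mulr_gt0// mulr_gt0.
  rewrite -!EFinM -EFinD; congr EFin.
  have r0 : 0 < Num.sqrt (1 + 2 * w * s) by rewrite sqrtr_gt0.
  have r2 := sqr_sqrtr (ltW d0).
  move: (Num.sqrt _) r0 r2 => r r0 r2.
  (* The transform of T[p_w] is (1 / r + 1) (r - 1) / (2 w s), and r^2 - 1 = 2 w s collapses it to 1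
     / r. *)
  transitivity ((r ^+ 2 - 1) / (2 * w * s * r)); first by field; rewrite !gt_eqF.
  by rewrite r2; field; rewrite !gt_eqF.
have mT := measurable_drm_operator mp p_ge0 p_supp.
have T_ge0 := drm_operator_ge0 mp p_ge0 p_supp.
have iT : mu.-integrable `]0, +oo[ (drm_operator p).
  apply/integrableP; split; first exact: measurable_funTS.
  have -> : (\int[mu]_(x in `]0%R, +oo[) `|drm_operator p x| = laplace (drm_operator p) 0)%E.
    by apply: eq_integral => x _; rewrite gee0_abs// mul0r oppr0 expR0 mul1e.
  by rewrite LT// laplace_drm_density// ltry.
(* Injectivity is stated for real functions. As T[p_w] has integral 1, it is finite almost
   everywhere, and truncating it to a real function changes it only on a null set of ]0, +oo[. *)
pose q (x : R) := fine (drm_operator p x).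
have qT : {ae mu, forall x, 0 < x -> (q x)%:E = drm_operator p x}.
  have mD : measurable (`]0, +oo[%classic : set (measurableTypeR R)).
    exact: measurable_itv.
  have := integrable_ae mD iT.
  apply: ae_imply => x Tx x0; rewrite /q fineK// Tx//=.
  by rewrite in_itv/= x0.
have mq : measurable_fun (`]0, +oo[ : set R) q.
  by apply: measurable_funTS; exact: measurableT_comp.
have iq : mu.-integrable `]0, +oo[ (EFin \o q).
  apply/integrableP; split; first exact/measurable_EFinP.
  case/integrableP : iT => _; apply: le_lt_trans.
  rewrite le_eqVlt; apply/orP; left; apply/eqP; apply: ae_eq_integral => //.
  + by apply: measurableT_comp => //; exact/measurable_EFinP.
  + by apply: measurableT_comp => //; exact: measurable_funTS.
  + by apply: ae_imply qT => x qx; rewrite /= in_itv/= andbT => x0; rewrite -qx.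
have : {ae mu, forall x, 0 < x -> q x = p x}.
  apply: laplace_inj => // s s0; rewrite -LT//; apply: ae_eq_integral => //.
  - apply: emeasurable_funM; apply/measurable_EFinP => //; exact: measurable_expRNM.
  - apply: emeasurable_funM; last exact: measurable_funTS.
    by apply/measurable_EFinP; exact: measurable_expRNM.
  - by apply: ae_imply qT => x qx; rewrite /= in_itv/= andbT => x0; rewrite qx.
by apply: ae_imply2 qT => x qx qp x0; rewrite -qx// qp.
Qed.

End equilibria.

(** Measurability of [p] serves the converse: agreeing almost everywhere with p_w does not make a
    function Borel, which [is_equilibrium] includes. *)
Theorem theorem1 (R : realType) :
  (forall p : R -> R, measurable_fun (`[0, +oo[ : set R) p ->
     (is_equilibrium p <->
      exists2 w : R, 0 < w &
        {ae @lebesgue_measure R, forall x : R, 0 < x ->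
           p x = drm_equilibrium_density w x})) /\
  (forall w : R, 0 < w ->
     is_equilibrium (drm_equilibrium_density w) /\
     mean_wealth (drm_equilibrium_density w) = w%:E).
Proof.
split=> [p mp|w w0]; last first.
  by split; [exact: drm_density_equilibrium|exact: mean_drm_density].
split=> [|[w w0 pw]]; first exact: equilibrium_ae_drm_density.
apply: (equilibrium_ae_eq mp (measurable_drm_density w) (drm_density_ge0 w) _ pw).
  by move=> x; exact: drm_density_le0.
exact: drm_density_equilibrium.
Qed.
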